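(* Let $f$ be an $n$-variate $m$-nomial whose Newton polytope $\mathrm{Newt}(f)$ is $n$-dimensional. Assume that $\mathrm{Newt}(f)$ is simplicial (i.e., for all $d<\dim\mathrm{Newt}(f)$, every $d$-dimensional face of $\mathrm{Newt}(f)$ has exactly $d+1$ vertices), and that whenever the relative interior of a face $Q$ of $\mathrm{Newt}(f)$ contains a point of $\mathrm{Supp}(f)$, $Q$ is a vertex. Then $Z_+(\mathrm{Init}_w(f))$ is smooth for all $w\in\mathbb{R}^n\setminus\{0\}$.
   Context: Let $\mathbb{R}^n_+=\{x\in\mathbb{R}^n: x_i>0\text{ for all }i\}$ and $x^a=x_1^{a_1}\cdots x_n^{a_n}$ for $a\in\mathbb{R}^n$ (real exponents allowed). An $n$-variate $m$-nomial is a function $f(x)=\sum_{a}c_ax^a$ on $\mathbb{R}^n_+$ with exactly $m$ monomial terms (distinct exponent vectors in $\mathbb{R}^n$, nonzero real coefficients $c_a$); $\mathrm{Supp}(f)=\{a: c_a\ne0\}$ and $\mathrm{Newt}(f)$ is the convex hull of $\mathrm{Supp}(f)$. For $w\in\mathbb{R}^n$, $\mathrm{Init}_w(f)$ is the sum of the terms $c_ax^a$ over those $a\in\mathrm{Supp}(f)$ minimizing $w\cdot a$. $Z_+(g)$ is the zero set of $g$ in $\mathbb{R}^n_+$; it is smooth if the gradient of $g$ is nonzero at each of its points (so the empty set is smooth). *)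

(* Defs.v *)
From HB Require Import structures.
From mathcomp Require Import all_boot all_order all_algebra finmap.
From mathcomp Require Import all_classical all_reals all_analysis.
Set Implicit Arguments.
Unset Strict Implicit.
Unset Printing Implicit Defensive.
Import Order.TTheory GRing.Theory Num.Theory.
Import numFieldNormedType.Exports.
Local Open Scope classical_set_scope.
Local Open Scope ring_scope.

(** * Polytopes in R^n *)

Definition dotv (R : realType) (n : nat) (w x : 'rV[R]_n) : R :=
  \sum_(i < n) w 0 i * x 0 i.

Definition conv_hull (R : realType) (n : nat) (A : set 'rV[R]_n) :
    set 'rV[R]_n :=
  smallest (@convex_set R 'rV[R]_n) A.

Definition affine_set (R : realType) (n : nat) (A : set 'rV[R]_n) : Prop :=
  forall (x y : 'rV[R]_n) (t : R), A x -> A y -> A (t *: x + (1 - t) *: y).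

Definition aff_hull (R : realType) (n : nat) (A : set 'rV[R]_n) :
    set 'rV[R]_n :=
  smallest (@affine_set R n) A.

(** The dimension of a set is that of its affine hull; the empty set has no
    dimension in this sense. *)
Definition has_dim (R : realType) (n : nat) (A : set 'rV[R]_n) (d : nat) :
    Prop :=
  exists (x : 'rV[R]_n) (U : {vspace 'rV[R]_n}),
    aff_hull A = [set y | y - x \in U] /\ \dim U = d.

Definition relint (R : realType) (n : nat) (A : set 'rV[R]_n) :
    set 'rV[R]_n :=
  [set x | A x /\ \forall y \near x, aff_hull A y -> A y].

(** The faces of a polytope are the sets of minimizers of linear functionals;
    [w = 0] gives [P] itself, which is therefore one of its own faces. *)
Definition face (R : realType) (n : nat) (P Q : set 'rV[R]_n) : Prop :=
  exists w : 'rV[R]_n,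
    Q = [set x | P x /\ forall y, P y -> dotv w x <= dotv w y].

Definition vertices (R : realType) (n : nat) (P : set 'rV[R]_n) :
    set 'rV[R]_n :=
  [set v | face P [set v]].

Definition simplicial (R : realType) (n : nat) (P : set 'rV[R]_n) : Prop :=
  forall (k d : nat) (Q : set 'rV[R]_n),
    has_dim P k -> (d < k)%N -> face P Q -> has_dim Q d ->
    (vertices Q #= `I_d.+1)%card.

(** * Fewnomials *)

(** A sum of finitely many terms [c_a x^a] with pairwise distinct real exponent
    vectors [a] and nonzero coefficients [c_a] is encoded by the finitely
    supported map [a |-> c_a]; [finsupp f] is then [Supp(f)]. *)
Definition fewnomial (R : realType) (n : nat) : Type :=
  {fsfun 'rV[R]_n -> R with 0}.

Definition is_nomial (R : realType) (n m : nat) (f : fewnomial R n) : Prop :=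
  #|` finsupp f| = m.

Definition monomial (R : realType) (n : nat) (a x : 'rV[R]_n) : R :=
  \prod_(i < n) (x 0 i) `^ (a 0 i).

(** Only the values on the open positive orthant are meaningful. *)
Definition feval (R : realType) (n : nat) (f : fewnomial R n) (x : 'rV[R]_n) :
    R :=
  \sum_(a <- finsupp f) f a * monomial a x.

Definition supp (R : realType) (n : nat) (f : fewnomial R n) :
    set 'rV[R]_n :=
  [set a | a \in finsupp f].

Definition newt (R : realType) (n : nat) (f : fewnomial R n) :
    set 'rV[R]_n :=
  conv_hull (supp f).

Definition init (R : realType) (n : nat) (w : 'rV[R]_n) (f : fewnomial R n) :
    fewnomial R n :=
  [fsfun a in [fset a in finsupp f |
                [forall b : finsupp f, dotv w a <= dotv w (val b)]]%fset
     => f a | 0].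

Definition pos_zeros (R : realType) (n : nat) (g : 'rV[R]_n -> R) :
    set 'rV[R]_n :=
  [set x : 'rV[R]_n | (forall i : 'I_n, 0 < x 0 i) /\ g x = 0].

Definition gradient (R : realType) (n : nat) (g : 'rV[R]_n -> R)
    (x : 'rV[R]_n) : 'rV[R]_n :=
  \row_(i < n) 'D_(delta_mx 0 i) g x.

Definition smooth_pos_zeros (R : realType) (n : nat) (g : 'rV[R]_n -> R) :
    Prop :=
  forall x, pos_zeros g x -> gradient g x != 0.

(* Main.v *)
Require Import Defs.
From mathcomp Require Import all_boot all_order all_algebra finmap.
From mathcomp Require Import all_classical all_reals all_analysis.
From mathcomp Require Import ring lra.
Import Order.TTheory GRing.Theory Num.Theory.
Import numFieldNormedType.Exports.
Local Open Scope classical_set_scope.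
Local Open Scope ring_scope.

(** Every exponent [a] lies in the relative interior of the smallest face
    containing it: by Stiemke's lemma, [a] is a strictly positive combination of
    the exponents on that face, which can be perturbed within the affine hull.
    Hence every exponent of [f] is a vertex of [Newt(f)].  For [w != 0] the
    exponents of [Init_w(f)] are then vertices of a [d]-dimensional proper face
    which they affinely span; simpliciality leaves at most [d + 1] of them, so
    they are affinely independent.  At a singular zero [x], both
    [\sum_a c_a x^a] and [\sum_a c_a x^a a] vanish, an affine dependence with
    nonzero coefficients. *)

(** * Bilinearity and definiteness of the dot product *)

Lemma dotvDr {R : realType} {n : nat} (w x y : 'rV[R]_n) :
  dotv w (x + y) = dotv w x + dotv w y.
Proof.
by rewrite /dotv -big_split; apply: eq_bigr => i _; rewrite !mxE mulrDr.
Qed.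

Lemma dotvC {R : realType} {n : nat} (x y : 'rV[R]_n) : dotv x y = dotv y x.
Proof. by apply: eq_bigr => i _; rewrite mulrC. Qed.

Lemma dotvZr {R : realType} {n : nat} (w x : 'rV[R]_n) k :
  dotv w (k *: x) = k * dotv w x.
Proof.
by rewrite /dotv mulr_sumr; apply: eq_bigr => i _; rewrite !mxE; ring.
Qed.

Lemma dotv0r {R : realType} {n : nat} (w : 'rV[R]_n) : dotv w 0 = 0.
Proof. by rewrite -(scale0r 0) dotvZr mul0r. Qed.

Lemma dotvBr {R : realType} {n : nat} (w x y : 'rV[R]_n) :
  dotv w (x - y) = dotv w x - dotv w y.
Proof. by rewrite -scaleN1r dotvDr dotvZr mulN1r. Qed.

Lemma dotvDl {R : realType} {n : nat} (v w x : 'rV[R]_n) :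
  dotv (v + w) x = dotv v x + dotv w x.
Proof. by rewrite !(dotvC _ x) dotvDr. Qed.

Lemma dotvZl {R : realType} {n : nat} (w x : 'rV[R]_n) k :
  dotv (k *: w) x = k * dotv w x.
Proof. by rewrite !(dotvC _ x) dotvZr. Qed.

Lemma dotvBl {R : realType} {n : nat} (v w x : 'rV[R]_n) :
  dotv (v - w) x = dotv v x - dotv w x.
Proof. by rewrite !(dotvC _ x) dotvBr. Qed.

Lemma dotv_sumr {R : realType} {n : nat} (I : Type) (r : seq I)
    (w : 'rV[R]_n) (l : I -> R) p :
  dotv w (\sum_(i <- r) l i *: p i) = \sum_(i <- r) l i * dotv w (p i).
Proof.
elim: r => [|i r IH]; first by rewrite !big_nil dotv0r.
by rewrite !big_cons dotvDr dotvZr IH.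
Qed.

Lemma dotvv_le0 {R : realType} {n : nat} (w : 'rV[R]_n) :
  dotv w w <= 0 -> w = 0.
Proof.
have sq_ge0 (i : 'I_n) : true -> 0 <= w 0 i * w 0 i by rewrite -expr2 sqr_ge0.
move=> w_le0.
have /eqP := le_anti (introT andP (conj w_le0 (sumr_ge0 _ sq_ge0))).
rewrite psumr_eq0// => /allP w0; apply/rowP => i; rewrite mxE.
by have /implyP/(_ isT) := w0 i (mem_index_enum i);
  rewrite mulf_eq0 orbb => /eqP.
Qed.

(** * Theorems of the alternative *)

(* Bartl's induction: a functional [u0] violating the conclusion for [s] alone
   is used to project everything along [v j] onto the kernel of [u0]. *)
Lemma farkas {R : realType} {n : nat} {I : eqType} {s : seq I}
    {v : I -> 'rV[R]_n} {c} :
  uniq s ->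
  (forall u, {in s, forall i, 0 <= dotv u (v i)} -> 0 <= dotv u c) ->
  exists2 l : I -> R, {in s, forall i, 0 <= l i}
    & c = \sum_(i <- s) l i *: v i.
Proof.
elim: s v c => [|j s IH] v c /=.
  move=> _ c_ge0; exists (fun=> 0) => //; rewrite big_nil; apply: dotvv_le0.
  have /= := c_ge0 (- c); rewrite -scaleN1r dotvZl mulN1r oppr_ge0; exact.
move=> /andP[js us] c_ge0.
(* Either the hypothesis already holds for [s], and [j] gets weight 0, or some [u0] separates [c]
   from the cone over [s]. *)
have [c_ge0'|/existsNP[u0 /not_implyP[u0s /negP]]] := pselect
    (forall u, {in s, forall i, 0 <= dotv u (v i)} -> 0 <= dotv u c).
  have [l l_ge0 ->] := IH _ _ us c_ge0'.
  exists (fun i => if i == j then 0 else l i).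
    by move=> i; rewrite inE; case: eqP => //= _; exact: l_ge0.
  rewrite big_cons eqxx scale0r add0r; apply: eq_big_seq => i is_.
  by case: eqP => // ij; rewrite -ij is_ in js.
rewrite -ltNge => u0c.
have u0j : dotv u0 (v j) < 0.
  rewrite ltNge; apply/negP => u0j; move: u0c; rewrite ltNge c_ge0// => i.
  by rewrite inE => /orP[/eqP->//|]; exact: u0s.
have u0j0 : dotv u0 (v j) != 0 by rewrite lt_eqF.
pose q x := dotv u0 x / dotv u0 (v j).
have [||l l_ge0] := IH (fun i => v i - q (v i) *: v j) (c - q c *: v j).
- exact: us.
- move=> u u_ge0.
  (* This is the adjoint of the projection. The functional on the right kills [v j], so the
     hypothesis on [j :: s] applies to it. *)
  have uE x : dotv u (x - q x *: v j) =
      dotv (u - (dotv u (v j) / dotv u0 (v j)) *: u0) x.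
    by rewrite dotvBr dotvZr dotvBl dotvZl /q; field.
  rewrite uE; apply: c_ge0 => i; rewrite inE => /orP[/eqP->|is_].
    by rewrite -uE /q divff// scale1r subrr dotv0r.
  by rewrite -uE u_ge0.
move/eqP; rewrite subr_eq => /eqP cE.
(* The weight of [v j] is nonnegative: [q c > 0] as [u0] is negative on both [c] and [v j], while
   [q (v i) <= 0] for [i] in [s]. *)
exists (fun i => if i == j then q c - \sum_(i <- s) l i * q (v i) else l i).
  move=> i; rewrite inE; case: eqP => //= _; last exact: l_ge0.
  move=> _; rewrite subr_ge0 (@le_trans _ _ 0)//; last first.
    by rewrite /q ltW// ltr_ndivlMr// mul0r.
  rewrite big_seq sumr_le0// => k ks; rewrite mulr_ge0_le0 ?l_ge0//.
  by rewrite /q ler_ndivrMr// mul0r u0s.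
rewrite {1}cE big_cons eqxx scalerBl scaler_suml.
under [X in X + _ = _]eq_bigr do rewrite scalerBr scalerA.
rewrite sumrB [RHS]addrC addrA addrAC; congr (_ - _ + _).
apply: eq_big_seq => i is_.
by case: eqP => // ij; rewrite -ij is_ in js.
Qed.

(** By [farkas], the hypothesis puts every [- v j] in the cone over the [v i]. Adding the relations
    [v j + \sum_i l j i *: v i = 0] over all [j] gives each vector a weight of at least 1. *)
Lemma stiemke {R : realType} {n : nat} {I : eqType} {s : seq I}
    {v : I -> 'rV[R]_n} :
  uniq s ->
  (forall u, {in s, forall i, 0 <= dotv u (v i)} ->
             {in s, forall i, dotv u (v i) = 0}) ->
  exists2 l : I -> R, {in s, forall i, 0 < l i}
    & \sum_(i <- s) l i *: v i = 0.
Proof.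
move=> us v0.
have /choice[l lP] j : exists l : I -> R, j \in s ->
    {in s, forall i, 0 <= l i} /\ - v j = \sum_(i <- s) l i *: v i.
  have [js|] := boolP (j \in s); last by exists (fun=> 0).
  have [|l l_ge0 lE] := @farkas _ _ _ _ v (- v j) us; last by exists l.
  by move=> u u_ge0; rewrite -scaleN1r dotvZr v0// mulr0.
exists (fun i => 1 + \sum_(j <- s) l j i).
  move=> i is_; rewrite ltr_wpDr// big_seq sumr_ge0// => j js.
  by have [+ _] := lP _ js; apply.
under eq_bigr do rewrite scalerDl scale1r scaler_suml.
rewrite big_split/= exchange_big/= -big_split/= big1_seq// => j /andP[_ js].
by have [_ <-] := lP _ js; rewrite subrr.
Qed.

(** * Convex hulls of finite sets *)

Lemma convex_setP {R : realType} {n : nat} (C : set 'rV[R]_n) :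
  convex_set C <->
  forall x y t, 0 <= t -> t <= 1 -> C x -> C y -> C (t *: x + (1 - t) *: y).
Proof.
split=> [cC x y t t0 t1 Cx Cy|cC x y t].
  by have := cC x y (Itv01 t0 t1); rewrite !inE; apply.
by rewrite !inE; apply: cC.
Qed.

Lemma convex_set_sum {R : realType} {n : nat} {I : eqType} (r : seq I)
    (p : I -> 'rV[R]_n) (l : I -> R) (C : set 'rV[R]_n) :
  convex_set C -> {in r, forall i, C (p i)} -> {in r, forall i, 0 <= l i} ->
  \sum_(i <- r) l i = 1 -> C (\sum_(i <- r) l i *: p i).
Proof.
move=> /convex_setP cC Cp l_ge0 l1.
(* Normalizing by the total weight lets the induction run over tails of [r], whose weights need not
   sum to 1. *)
suff H : 0 < \sum_(i <- r) l i ->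
    C ((\sum_(i <- r) l i)^-1 *: \sum_(i <- r) l i *: p i).
  by move: H; rewrite l1 ltr01 invr1 scale1r; exact.
elim: r {l1} Cp l_ge0 => [|i r IH] Cp l_ge0; first by rewrite big_nil ltxx.
have Cpi : C (p i) by apply: Cp; rewrite mem_head.
have li_ge0 : 0 <= l i by apply: l_ge0; rewrite mem_head.
have {}Cp : {in r, forall i, C (p i)}.
  by move=> k kr; apply: Cp; rewrite inE kr orbT.
have {}l_ge0 : {in r, forall i, 0 <= l i}.
  by move=> k kr; apply: l_ge0; rewrite inE kr orbT.
rewrite !big_cons; set s := \sum_(k <- r) l k in IH *.
have : 0 <= s by rewrite /s big_seq sumr_ge0.
rewrite le_eqVlt => /predU1P[s0|s_gt0].
  rewrite -s0 addr0 => li_gt0.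
  rewrite big1_seq => [|k /andP[_ kr]]; last first.
    move/esym/eqP: s0; rewrite /s big_seq psumr_eq0// => /allP/(_ k kr).
    by rewrite kr => /eqP ->; rewrite scale0r.
  by rewrite addr0 scalerA mulVf ?gt_eqF// scale1r.
move=> ls_gt0; have := cC _ _ (l i / (l i + s)) _ _ Cpi (IH Cp l_ge0 s_gt0).
have -> : 1 - l i / (l i + s) = s / (l i + s) by field; rewrite gt_eqF.
rewrite scalerA mulrAC divff ?gt_eqF// mul1r [l i / _]mulrC -scalerA -scalerDr.
apply; first by rewrite mulr_ge0// invr_ge0 ltW.
by rewrite mulrC ler_pdivrMr// mul1r lerDl ltW.
Qed.

Lemma conv_hull_convex {R : realType} {n : nat} (A : set 'rV[R]_n) :
  convex_set (conv_hull A).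
Proof.
apply/convex_setP => x y t t0 t1 Ax Ay C [cC AC].
by move/convex_setP: (cC); apply => //; [apply: Ax|apply: Ay].
Qed.

Lemma sub_conv_hull {R : realType} {n : nat} (A : set 'rV[R]_n) :
  A `<=` conv_hull A.
Proof. by move=> x Ax C [_]; apply. Qed.

Lemma conv_hullP {R : realType} {n : nat} {S : seq 'rV[R]_n} {x : 'rV[R]_n} :
  uniq S ->
  conv_hull [set` S] x <->
  exists l : 'rV[R]_n -> R, [/\ {in S, forall b, 0 <= l b},
    \sum_(b <- S) l b = 1 & x = \sum_(b <- S) l b *: b].
Proof.
move=> uS; split=> [Sx|[l [l_ge0 l1 ->]]]; last first.
  apply: convex_set_sum => //; first exact: conv_hull_convex.
  by move=> b bS; exact: sub_conv_hull.
apply: (Sx [set y | exists l : 'rV[R]_n -> R, [/\ {in S, forall b, 0 <= l b},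
  \sum_(b <- S) l b = 1 & y = \sum_(b <- S) l b *: b]]); split.
  apply/convex_setP => _ _ t t0 t1 [l [l0 l1 ->]] [k [k0 k1 ->]].
  exists (fun b => t * l b + (1 - t) * k b); split.
  - by move=> b bS; rewrite addr_ge0// mulr_ge0 ?l0 ?k0// subr_ge0.
  - by rewrite big_split -!mulr_sumr/= l1 k1; ring.
  - rewrite !scaler_sumr -big_split; apply: eq_bigr => b _ /=.
    by rewrite !scalerA -scalerDl.
move=> a aS; exists (fun b => (b == a)%:R); split=> //.
- rewrite (bigD1_seq a)//= eqxx big1 ?addr0// => b.
  by move=> /negPf ->.
- rewrite (bigD1_seq a)//= eqxx scale1r big1 ?addr0// => b.
  by move=> /negPf ->; rewrite scale0r.
Qed.

(** * Affine hulls and relative interiors *)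

Definition dirspan {R : realType} {n : nat} (T : seq 'rV[R]_n)
    (a0 : 'rV[R]_n) :=
  <<[seq b - a0 | b <- T]>>%VS.

(** The flat on the right is affine and contains the hull of [T]. Conversely, an affine set through
    [a0], translated by [- a0], is a linear subspace: it is closed under scaling by combining with
    [a0], and under addition by doubling a midpoint. *)
Lemma aff_hullE {R : realType} {n : nat} (T : seq 'rV[R]_n) (a0 : 'rV[R]_n) C :
  uniq T -> a0 \in T -> [set` T] `<=` C -> C `<=` conv_hull [set` T] ->
  aff_hull C = [set y | y - a0 \in dirspan T a0].
Proof.
move=> uT a0T TC CT; apply/seteqP; split=> y.
  move=> Cy; apply: (Cy [set z | z - a0 \in dirspan T a0]); split.
    move=> u v t /= uU vU.
    rewrite (_ : _ - _ = t *: (u - a0) + (1 - t) *: (v - a0)).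
      by rewrite memvD// memvZ.
    by apply/rowP => i; rewrite !mxE; ring.
  move=> x /CT /(conv_hullP uT) [l [_ l1 ->]] /=.
  rewrite -[X in _ - X](scale1r a0) -l1 scaler_suml -sumrB big_seq.
  apply: memv_suml => b bT; rewrite -scalerBr memvZ// memv_span//.
  exact: map_f.
move=> /= yU D [affD CD].
have Da0 : D a0 by exact/CD/TC.
have DZ t z : D (a0 + z) -> D (a0 + t *: z).
  move=> Dz; rewrite (_ : _ + _ = t *: (a0 + z) + (1 - t) *: a0).
    exact: affD.
  by apply/rowP => i; rewrite !mxE; ring.
have DD y' z : D (a0 + y') -> D (a0 + z) -> D (a0 + (y' + z)).
  move=> Dy Dz.
  rewrite (_ : y' + z = 2 *: (2^-1 *: y' + (1 - 2^-1) *: z)); last first.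
    by apply/rowP => i; rewrite !mxE; field.
  apply: DZ; rewrite (_ : a0 + _ =
      2^-1 *: (a0 + y') + (1 - 2^-1) *: (a0 + z)); first exact: affD.
  by apply/rowP => i; rewrite !mxE; ring.
rewrite -(subrK a0 y) addrC (coord_span (X := in_tuple _) yU).
elim/big_ind : _ => [|u v|i _]; [by rewrite addr0|exact: DD|].
have iT : (i < size T)%N by case: i => i /=; rewrite size_map.
apply: DZ; rewrite (nth_map 0)//= addrC subrK.
exact/CD/TC/mem_nth.
Qed.

Lemma scalar_rV_continuous {R : realType} {n : nat}
    (g : {scalar 'rV[R]_n}) : continuous (g : 'rV[R]_n -> R).
Proof.
have -> : (g : _ -> _) = (fun v => \sum_(j < n) v 0 j * g 'e_j).
  apply/funext => v; rewrite {1}(row_sum_delta v) linear_sum.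
  by apply: eq_bigr => j _; rewrite linearZ.
apply: continuous_big => [|j _ v]; first exact: add_continuous.
apply: cvgMr_tmp; first exact: (nbhs_filter v).
exact: (@coord_continuous R 1 n 0 j v).
Qed.

(** The relation on [l] makes [a] a barycentre of [T] with strictly positive weights. Nearby points
    of the affine hull have weights close to these, hence still positive. *)
Lemma relint_conv_hull {R : realType} {n : nat} (T : seq 'rV[R]_n)
    (a : 'rV[R]_n)    (l : 'rV[R]_n -> R) :
  uniq T -> a \in T -> {in T, forall b, 0 < l b} ->
  \sum_(b <- T) l b *: (b - a) = 0 ->
  relint (conv_hull [set` T]) a.
Proof.
move=> uT aT l_gt0 l0; split; first exact: sub_conv_hull.
rewrite (aff_hullE T a) => //; last exact: sub_conv_hull.
(* [X] contains [a - a = 0], so it is not free, but [coord X] is still linear and supplies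
   coefficients for every vector of the span. *)
pose X := [tuple of [seq b - a | b <- in_tuple T]].
pose L := \sum_(b <- T) l b.
have L_gt0 : 0 < L.
  rewrite /L (bigD1_seq a)//= ltr_pwDl ?l_gt0// big_seq_cond.
  by rewrite sumr_ge0// => b /andP[bT _]; rewrite ltW// l_gt0.
pose mu i (y : 'rV[R]_n) : R := coord X i (y - a).
have Fa : Filter (nbhs a) := nbhs_filter a.
have mu_cont i : mu i y @[y --> a] --> mu i a.
  apply: (@cvg_comp _ _ _ (fun y => y - a) (coord X i) _ (nbhs (a - a))).
    exact: (cvgB (FF := Fa) cvg_id (cvg_cst (FF := Fa) a)).
  exact: scalar_rV_continuous.
pose k (i : 'I_(size T)) (y : 'rV[R]_n) : R :=
  (1 - \sum_j mu j y) * (l T`_i / L) + mu i y.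
have k_cont i : k i y @[y --> a] --> k i a.
  apply: cvgD => //; apply: cvgMr_tmp => //; apply: cvgB => //.
    exact: cvg_cst.
  by apply: cvg_big => [|j _]; [exact: add_continuous|exact: mu_cont].
have k_gt0 i : 0 < k i a.
  have mu0 j : mu j a = 0 by rewrite /mu subrr linear0.
  by rewrite /k mu0 big1// subr0 mul1r addr0 divr_gt0// l_gt0// mem_nth.
have : \forall y \near a, forall i, 0 < k i y.
  apply: (@filter_forall _ _ _ (nbhs a)) => i.
  exact: cvgr_gt (k_cont i) _ (k_gt0 i).
apply: filterS => y ky yU.
have yE : y = \sum_(i < size T) k i y *: T`_i.
  have := coord_span (X := X) yU.
  rewrite -[LHS]/(y - a).
  under eq_bigr => i _ do rewrite (nth_map 0)// scalerBr -/(mu i y).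
  rewrite sumrB -scaler_suml => /eqP.
  rewrite subr_eq => /eqP yE.
  under eq_bigr do rewrite scalerDl -scalerA.
  rewrite big_split/= -scaler_sumr.
  have aE : \sum_(i < size T) (l T`_i / L) *: T`_i = a.
    transitivity (L^-1 *: \sum_(b <- T) l b *: b).
      rewrite (big_nth 0) big_mkord scaler_sumr.
      by apply: eq_bigr => i _; rewrite scalerA mulrC.
    move: l0; under eq_bigr do rewrite scalerBr.
    rewrite sumrB -scaler_suml => /eqP; rewrite subr_eq0 => /eqP ->.
    by rewrite scalerA mulVf ?scale1r// gt_eqF.
  rewrite aE scalerBl scale1r {1}yE.
  by apply/rowP => i; rewrite !mxE; ring.
rewrite yE; apply: convex_set_sum.
- exact: conv_hull_convex.
- by move=> i _; apply: sub_conv_hull; exact: mem_nth.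
- by move=> i _; rewrite ltW.
- rewrite big_split/= -mulr_sumr -mulr_suml.
  rewrite -(big_mkord xpredT (fun i => l T`_i)) -(big_nth 0 xpredT l) divff.
    by rewrite mulr1 subrK.
  by rewrite gt_eqF.
Qed.

(** * Faces as hulls of minimizing points *)

Definition argmins {R : realType} {n : nat} (w : 'rV[R]_n) (S : seq 'rV[R]_n) :=
  [seq a <- S | all (fun b => dotv w a <= dotv w b) S].

Lemma mem_argmins {R : realType} {n : nat} {w : 'rV[R]_n}
    {S : seq 'rV[R]_n} {a : 'rV[R]_n} :
  a \in argmins w S ->
  a \in S /\ {in S, forall b, dotv w a <= dotv w b}.
Proof. by rewrite mem_filter => /andP[/allP + ->]. Qed.

Lemma argmins_eq {R : realType} {n : nat} {w : 'rV[R]_n}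
    {S : seq 'rV[R]_n} {a b : 'rV[R]_n} :
  a \in argmins w S -> b \in argmins w S -> dotv w a = dotv w b.
Proof.
move=> /mem_argmins[aS wa] /mem_argmins[bS wb].
by apply/eqP; rewrite eq_le wa//= wb.
Qed.

Lemma argmins_lt {R : realType} {n : nat} {w : 'rV[R]_n}
    {S : seq 'rV[R]_n} {a b : 'rV[R]_n} :
  a \in argmins w S -> b \in S -> b \notin argmins w S ->
  dotv w a < dotv w b.
Proof.
move=> /mem_argmins[aS wa] bS; rewrite mem_filter bS andbT => /allPn[c cS].
by rewrite -ltNge; exact: le_lt_trans (wa _ cS).
Qed.

Lemma argmins_exists {R : realType} {n : nat} (w : 'rV[R]_n) S :
  S != [::] -> exists a, a \in argmins w S.
Proof.
have [->//|[a aS wa] _] : S = [::] \/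
    exists2 a, a \in S & {in S, forall b, dotv w a <= dotv w b}; last first.
  by exists a; rewrite mem_filter aS andbT; apply/allP.
elim: S => [|c S IH]; [by left|right].
case: IH => [->|[a aS wa]].
  by exists c; rewrite ?mem_head// => b; rewrite inE => /eqP->.
have [wac|wca] := leP (dotv w a) (dotv w c).
  by exists a => [|b]; rewrite inE ?aS ?orbT// => /predU1P[->//|/wa].
exists c => [|b]; rewrite inE ?eqxx// => /predU1P[->//|/wa].
exact/le_trans/ltW.
Qed.

Lemma conv_hull_dotv_ge {R : realType} {n : nat} (w : 'rV[R]_n) A m x :
  (forall b, A b -> m <= dotv w b) -> conv_hull A x -> m <= dotv w x.
Proof.
move=> Am Ax; apply: (Ax [set y | m <= dotv w y]); split=> //.
apply/convex_setP => y z t t0 t1 /= my mz; rewrite dotvDr !dotvZr.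
rewrite -[leLHS](_ : t * m + (1 - t) * m = _); last by ring.
by rewrite lerD// ler_wpM2l// subr_ge0.
Qed.

(** Write a minimizer as a convex combination of [S]. The nonnegative gaps [dotv w b - dotv w a]
    then have weighted sum 0, so points outside [argmins w S] get weight 0. *)
Lemma face_argmins {R : realType} {n : nat} (w : 'rV[R]_n) S a :
  uniq S -> a \in argmins w S ->
  [set x | conv_hull [set` S] x /\
           forall y, conv_hull [set` S] y -> dotv w x <= dotv w y] =
  conv_hull [set` argmins w S].
Proof.
move=> uS aT; have [aS wa] := mem_argmins aT.
have uT : uniq (argmins w S) by rewrite filter_uniq.
apply/seteqP; split=> x /= => [[Sx wx]|Tx].
  have /(conv_hullP uS)[l [l_ge0 l1 xE]] := Sx.
  have l0 b : b \in S -> b \notin argmins w S -> l b = 0.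
    have wl : \sum_(b <- S) l b * (dotv w b - dotv w a) = 0.
      apply/eqP; rewrite eq_le; apply/andP; split; last first.
        rewrite big_seq sumr_ge0// => c cS.
        by rewrite mulr_ge0 ?l_ge0// subr_ge0 wa.
      under eq_bigr do rewrite mulrBr.
      rewrite sumrB -mulr_suml l1 mul1r subr_le0 -dotv_sumr -xE wx//.
      exact: sub_conv_hull.
    move=> bS bT; move/eqP: wl; rewrite big_seq psumr_eq0 => [|c cS].
      move=> /allP/(_ b bS); rewrite bS/= mulf_eq0 => /orP[/eqP//|].
      by rewrite subr_eq0 gt_eqF//; exact: argmins_lt bT.
    by rewrite mulr_ge0 ?l_ge0// subr_ge0 wa.
  have sumT (V : nmodType) (F : 'rV[R]_n -> V) :
      (forall b, l b = 0 -> F b = 0) ->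
      \sum_(b <- S) F b = \sum_(b <- argmins w S) F b.
    move=> F0; rewrite big_filter [RHS]big_mkcond/=; apply: eq_big_seq => b bS.
    by case: ifPn => // bT; apply/F0/l0 => //; rewrite mem_filter bS andbT.
  apply/(conv_hullP uT); exists l; split.
  - by move=> b /mem_argmins[bS _]; exact: l_ge0.
  - by rewrite -l1 (sumT _ l).
  - by rewrite xE; apply: sumT => b ->; rewrite scale0r.
split; first apply: Tx.
  split; first exact: conv_hull_convex.
  by move=> b /mem_argmins[bS _]; exact: sub_conv_hull.
move=> y Sy; apply: (@le_trans _ _ (dotv w a)); last first.
  by apply: conv_hull_dotv_ge Sy => b; exact: wa.
(* The upper bound on [dotv w x] is a lower bound for the opposite functional. *)
suff : - dotv w a <= dotv (-1 *: w) x by rewrite dotvZl mulN1r lerN2.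
apply: conv_hull_dotv_ge Tx => b /= bT.
by rewrite dotvZl mulN1r (argmins_eq aT bT).
Qed.

(** This serves to weight one functional so heavily that its strict inequalities survive the
    addition of another. *)
Lemma dominating_scalar {R : realType} {I : eqType} (s : seq I) (d e : I -> R) :
  exists K : R, {in s, forall i, 0 < d i -> 0 < K * d i + e i}.
Proof.
elim: s => [|j s [K KP]]; first by exists 0.
have [dj|dj] := ltP 0 (d j); last first.
  exists K => i; rewrite inE => /orP[/eqP->|/KP//].
  by rewrite ltNge dj.
(* The second bound makes the value at [j] at least [1 + |e j| + e j >= 1]. *)
exists (Num.max K ((1 + `|e j|) / d j)) => i.
rewrite inE => /orP[/eqP->|is_] di.
  apply: (@lt_le_trans _ _ ((1 + `|e j|) / d j * d j + e j)).
    by rewrite divfK ?gt_eqF//; have := ler_norm (- e j); rewrite normrN; lra.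
  by rewrite lerD2r ler_pM2r// le_max lexx orbT.
apply: lt_le_trans (KP _ is_ di) _.
by rewrite lerD2r ler_pM2r// le_max lexx.
Qed.

(* Tilting [w] slightly towards [u] cuts the face of [w] down to the face of
   that face on which [u] is minimal. *)
Lemma argmins_tilt {R : realType} {n : nat} (w u : 'rV[R]_n) S a b :
  a \in argmins w S -> {in argmins w S, forall c, dotv u a <= dotv u c} ->
  b \in argmins w S -> dotv u a != dotv u b ->
  exists w', [/\ a \in argmins w' S, {subset argmins w' S <= argmins w S}
                & b \notin argmins w' S].
Proof.
move=> aT ua bT uab; have [aS wa] := mem_argmins aT.
have [K KP] := dominating_scalar S (fun c => dotv w c - dotv w a)
  (fun c => dotv u c - dotv u a).
have lt_w' c : c \in S -> c \notin argmins w S ->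
    dotv (K *: w + u) a < dotv (K *: w + u) c.
  move=> cS cT; have := KP c cS; rewrite subr_gt0 (argmins_lt aT)//.
  by move=> /(_ isT); rewrite !dotvDl !dotvZl; lra.
have aT' : a \in argmins (K *: w + u) S.
  rewrite mem_filter aS andbT; apply/allP => c cS.
  have [cT|cT] := boolP (c \in argmins w S); last by rewrite ltW// lt_w'.
  by rewrite !dotvDl !dotvZl (argmins_eq aT cT) lerD2l ua.
exists (K *: w + u); split=> //.
  move=> c cT'; have [cS wc] := mem_argmins cT'.
  apply/negPn/negP => cT; have := lt_w' _ cS cT.
  by rewrite (argmins_eq aT' cT') ltxx.
apply/negP => bT'; have := argmins_eq aT' bT'.
rewrite !dotvDl !dotvZl (argmins_eq aT bT) => /addrI uE.
by rewrite uE eqxx in uab.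
Qed.

(** Starting from [w = 0], where every point minimizes, tilt as long as some functional is minimal
    at [a] without being constant on the face. Each tilt discards a point, so the process stops. *)
Lemma smallest_face {R : realType} {n : nat} (S : seq 'rV[R]_n) a :
  uniq S -> a \in S ->
  exists2 w, a \in argmins w S & forall u,
    {in argmins w S, forall b, dotv u a <= dotv u b} ->
    {in argmins w S, forall b, dotv u a = dotv u b}.
Proof.
move=> uS aS.
have : a \in argmins 0 S.
  rewrite mem_filter aS andbT; apply/allP => b _.
  by rewrite !(dotvC 0) !dotv0r.
have [k] := ubnP (size (argmins 0 S)); elim: k (0 : 'rV[R]_n) => // k IH w.
rewrite ltnS => kw aT.
have [?|/existsNP[u /not_implyP[ua /existsNP[b /not_implyP[bT /eqP uab]]]]] :=
  pselect (forall u, {in argmins w S, forall b, dotv u a <= dotv u b} ->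
    {in argmins w S, forall b, dotv u a = dotv u b}); first by exists w.
have [w' [aT' sT' bT']] := argmins_tilt _ _ _ _ _ aT ua bT uab.
apply: (IH w') => //; apply: leq_trans kw.
(* Adjoining the discarded [b] shows that the new list is strictly shorter. *)
have : {subset b :: argmins w' S <= argmins w S}.
  by move=> c; rewrite inE => /orP[/eqP->//|/sT'].
by apply: uniq_leq_size; rewrite /= bT' filter_uniq.
Qed.

(** The property given by [smallest_face], read on the differences [b - a], is the hypothesis of
    [stiemke]. *)
Lemma relint_face {R : realType} {n : nat} (S : seq 'rV[R]_n) a :
  uniq S -> a \in S ->
  exists2 Q, face (conv_hull [set` S]) Q & relint Q a.
Proof.
move=> uS aS; have [w aT uT] := smallest_face S a uS aS.
exists (conv_hull [set` argmins w S]).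
  by exists w; rewrite (face_argmins w S a).
have [||l l_gt0 l0] := @stiemke _ _ _ (argmins w S) (fun b => b - a).
- by rewrite filter_uniq.
- move=> u u_ge0 b bT; rewrite dotvBr (uT u _ b bT) ?subrr// => c cT.
  by have := u_ge0 c cT; rewrite dotvBr subr_ge0.
- by apply: (relint_conv_hull _ _ l) => //; rewrite filter_uniq.
Qed.

(** The differences span the direction space [U] of the face. Simpliciality leaves at most [\dim U]
    elements in [T], and a spanning family of that size is free. *)
Lemma face_conv_hull_free {R : realType} {n : nat} (S : seq 'rV[R]_n)
    (w : 'rV[R]_n) a T :
  uniq S -> has_dim (conv_hull [set` S]) n -> simplicial (conv_hull [set` S]) ->
  {in S, forall b, vertices (conv_hull [set` S]) b} -> w != 0 ->
  argmins w S = a :: T -> free [seq b - a | b <- T].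
Proof.
move=> uS dimS simpS vS w0 wE.
have aT : a \in argmins w S by rewrite wE mem_head.
have uT : uniq (argmins w S) by rewrite filter_uniq.
set P := conv_hull [set` S] in dimS simpS vS.
pose F := conv_hull [set` argmins w S].
have FP : face P F by exists w; rewrite (face_argmins w S a).
pose U := dirspan (argmins w S) a.
have UE : U = <<[seq b - a | b <- T]>>%VS.
  rewrite /U /dirspan wE/= subrr span_cons.
  by rewrite (_ : <[0]>%VS = 0%VS) ?add0v//;
    apply/eqP; rewrite -dimv_eq0 dim_vline eqxx.
have dimF : has_dim F (\dim U).
  exists a, U; split=> //; apply: aff_hullE => //.
  exact: sub_conv_hull.
(* Simpliciality only constrains proper faces. If [U] were the whole space, [w] would be a
   combination of differences orthogonal to it, forcing [w = 0]. *)
have ltU : (\dim U < n)%N.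
  have leU : (\dim U <= n)%N.
    by rewrite (leq_trans (dimvS (subvf U)))// dimvf /dim/= mul1n.
  rewrite ltn_neqAle leU andbT; apply/negP => /eqP dimU.
  have UT : U = fullv.
    by apply/eqP; rewrite eqEdim subvf dimU dimvf /dim/= mul1n leqnn.
  move/eqP: w0; apply; apply: dotvv_le0.
  have : w \in U by rewrite UT memvf.
  rewrite UE => /(coord_span (X := in_tuple _)) {2}->.
  rewrite dotv_sumr big1// => i _.
  have iT : (i < size T)%N by case: i => i /=; rewrite size_map.
  rewrite (nth_map 0)//= dotvBr (argmins_eq aT (b := T`_i)).
    by rewrite subrr mulr0.
  by rewrite wE inE mem_nth// orbT.
(* A functional exposing [b] in [P] also exposes it in the smaller set [F]. *)
have vF b : b \in argmins w S -> vertices F b.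
  move=> bT; have [bS wb] := mem_argmins bT.
  have [u uE] := vS _ bS; exists u.
  have Fb : F b by exact: sub_conv_hull.
  have FsubP : F `<=` P.
    by rewrite /F -(face_argmins w S a)// => y [].
  have [Pb ub] : [set x | P x /\ forall y, P y -> dotv u x <= dotv u y] b.
    by rewrite -uE.
  apply/seteqP; split=> x /= => [->|[Fx ux]].
    by split=> // y /FsubP; exact: ub.
  suff : [set b] x by [].
  rewrite uE; split; first exact: FsubP.
  by move=> y Py; rewrite (le_trans (ux _ Fb))// ub.
have cardF := simpS _ _ _ dimS ltU FP dimF.
have : (size (argmins w S) <= (\dim U).+1)%N.
  pose A := [fset b in argmins w S]%fset.
  have <- : #|` A| = size (argmins w S) by rewrite card_fseq undup_id.
  have cardA : ([set` A] #= `I_#|` A|)%card by exact/card_eq_fsetP.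
  rewrite -card_le_II -(card_le_eql cardA) -(card_le_eqr cardF).
  by apply: subset_card_le => b /=; rewrite inE; exact: vF.
rewrite wE /= ltnS => sT.
by rewrite /free eqn_leq dim_span size_map -UE sT.
Qed.

(** * Partial derivatives of fewnomials *)

Lemma derive_line {R : realType} {V : normedModType R} (g : V -> R) x v d :
  is_derive (0 : R) (1 : R) (fun h : R => g (h *: v + x)) d -> 'D_v g x = d.
Proof.
move=> [_ <-]; rewrite /derive.
set g1 := fun h => h^-1 *: _; set g2 := fun h => h^-1 *: _.
suff -> : g1 = g2 by [].
by apply/funext => h; rewrite /g1 /g2/= addr0 scale0r add0r [_%:A]mulr1.
Qed.

Lemma monomial_gt0 {R : realType} {n : nat} (a x : 'rV[R]_n) :
  (forall i, 0 < x 0 i) -> 0 < monomial a x.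
Proof. by move=> x_gt0; apply: prodr_gt0 => i _; rewrite powR_gt0. Qed.

(** Along the [i]-th axis only one factor varies, so the power rule applies; positivity of [x 0 i]
    turns the exponent [a 0 i - 1] into a division. *)
Lemma is_derive_monomial_line {R : realType} {n : nat} (a x : 'rV[R]_n) i :
  (forall i, 0 < x 0 i) ->
  is_derive (0 : R) (1 : R) (fun h : R => monomial a (h *: delta_mx 0 i + x))
    (a 0 i * monomial a x / x 0 i).
Proof.
move=> x_gt0; pose c := \prod_(j < n | j != i) x 0 j `^ a 0 j.
have -> : (fun h : R => monomial a (h *: delta_mx 0 i + x)) =
    c \*: ((@powR R)^~ (a 0 i) \o (fun h => h + x 0 i)).
  apply/funext => h; rewrite /monomial (bigD1 i)//= mulrC.
  rewrite !mxE !eqxx mulr1; congr (_ * _).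
  by apply: eq_bigr => j /negPf ji; rewrite !mxE eqxx ji mulr0 add0r.
have -> : a 0 i * monomial a x / x 0 i =
    c *: (a 0 i * (0 + x 0 i) `^ (a 0 i - 1) * (1 + 0)).
  rewrite /monomial (bigD1 i)//= -/c add0r addr0 mulr1 powRB ?powRr1 ?ltW//.
    by rewrite -[RHS]/(c * _); field; rewrite gt_eqF.
  by rewrite (gt_eqF (x_gt0 i)) implybT.
apply: is_deriveZ; apply: is_derive1_comp.
by apply: is_derive1_powR; rewrite add0r.
Qed.

(** With [x 0 i] factored out, a vanishing gradient becomes a linear relation between exponent
    vectors. *)
Lemma derive_nomial {R : realType} {n : nat} (T : seq 'rV[R]_n)
    (c : 'rV[R]_n -> R) (x : 'rV[R]_n) i :
  (forall i, 0 < x 0 i) ->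
  'D_(delta_mx 0 i) (fun y => \sum_(a <- T) c a * monomial a y) x =
  (\sum_(a <- T) c a * monomial a x * a 0 i) / x 0 i.
Proof.
move=> x_gt0; apply: derive_line; rewrite mulr_suml.
elim: T => [|a T IH].
  rewrite big_nil (_ : (fun _ => _) = cst 0); first exact: is_derive_cst.
  by apply/funext => h; rewrite big_nil.
rewrite big_cons (_ : (fun _ => _) =
    (c a \*: (fun h : R => monomial a (h *: delta_mx 0 i + x)))
    + (fun h : R => \sum_(b <- T) c b * monomial b (h *: delta_mx 0 i + x))).
  apply: is_deriveD => //.
  rewrite -[_ / _]mulrA -mulrA
    (_ : _ * (_ * _) = c a *: (a 0 i * monomial a x / x 0 i)).
    by apply: is_deriveZ; exact: is_derive_monomial_line.
  by rewrite -[RHS]/(c a * _); ring.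
by apply/funext => h; rewrite big_cons.
Qed.

(** * Initial forms and their singular zeros *)

Lemma feval_initE {R : realType} {n : nat} (w : 'rV[R]_n) (f : fewnomial R n) :
  feval (init w f) =
  fun x => \sum_(a <- argmins w (finsupp f)) f a * monomial a x.
Proof.
apply/funext => x; rewrite /feval.
have initE a : init w f a = if a \in argmins w (finsupp f) then f a else 0.
  rewrite /init fsfunE !inE mem_filter andbC; congr (if _ && _ then _ else _).
  apply/forallP/allP => /= [wa b bf|wa b]; last exact/wa/valP.
  exact: (wa [` bf]%fset).
rewrite (perm_big (argmins w (finsupp f)))/=.
  by apply: eq_big_seq => a aT; rewrite initE aT.
apply: uniq_perm; [exact: fset_uniq|by rewrite filter_uniq ?fset_uniq|].
move=> a; rewrite mem_finsupp initE; case: ifPn => [|_]; last by rewrite eqxx.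
by move/mem_argmins => [+ _]; rewrite mem_finsupp.
Qed.

(** A form of [freeP] with coefficients attached to the elements of [T] rather than to positions. *)
Lemma free_map_sum {K : fieldType} {vT : vectType K} {I : eqType} {T : seq I}
    {h : I -> vT} {c : I -> K} :
  free [seq h b | b <- T] -> \sum_(b <- T) c b *: h b = 0 ->
  {in T, forall b, c b = 0}.
Proof.
move=> /(freeP (X := map_tuple h (in_tuple T))) freeT sum0 b bT.
have iT : (index b T < size T)%N by rewrite index_mem.
have := freeT (fun i => c (tnth (in_tuple T) i)) _ (Ordinal iT).
rewrite (tnth_nth b)/= nth_index//; apply.
rewrite big_tnth in sum0; rewrite -[RHS]sum0; apply: eq_bigr => i _.
by rewrite -(tnth_nth 0 (map_tuple h (in_tuple T))) tnth_map.
Qed.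

Theorem corollary3 (R : realType) (n m : nat) (f : fewnomial R n)
  (f_nomial : is_nomial m f)
  (newt_dim : has_dim (newt f) n)
  (newt_simplicial : simplicial (newt f))
  (supp_vertex : forall Q : set 'rV[R]_n, face (newt f) Q ->
     (exists a : 'rV[R]_n, supp f a /\ relint Q a) ->
     exists2 v : 'rV[R]_n, vertices (newt f) v & Q = [set v])
  (w : 'rV[R]_n) (w_neq0 : w != 0) :
  smooth_pos_zeros (feval (init w f)).
Proof.
rewrite feval_initE => x [x_gt0 fx0]; apply/eqP => grad0.
have uS : uniq (finsupp f) by exact: fset_uniq.
have vS : {in (finsupp f : seq _), forall a, vertices (newt f) a}.
  move=> a aS; have [Q fQ Qa] := relint_face _ a uS aS.
  have [|v vv Qv] := supp_vertex Q fQ; first by exists a.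
  by move: Qa; rewrite Qv => -[/= -> _].
pose c b := f b * monomial b x.
have c_neq0 b : b \in argmins w (finsupp f) -> c b != 0.
  move=> /mem_argmins[+ _]; rewrite mem_finsupp => fb.
  by rewrite mulf_neq0// gt_eqF// monomial_gt0.
(* The [i]-th entry of the gradient is the [i]-th coordinate of this sum divided by [x 0 i]. *)
have cb0 : \sum_(b <- argmins w (finsupp f)) c b *: b = 0.
  apply/rowP => i; rewrite summxE mxE.
  move/rowP/(_ i) : grad0; rewrite !mxE derive_nomial// => /eqP.
  rewrite mulf_eq0 invr_eq0 (gt_eqF (x_gt0 i)) orbF => /eqP gi.
  by apply: etrans gi; apply: eq_bigr => b _; rewrite !mxE.
have c0 : \sum_(b <- argmins w (finsupp f)) c b = 0 by exact: fx0.
(* The support is nonempty, since the affine hull of an empty polytope is empty and has no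
   dimension. *)
have [a aT] : exists a, a \in argmins w (finsupp f).
  apply: argmins_exists; apply/eqP => S0.
  have [y [U [affE _]]] := newt_dim.
  have : aff_hull (newt f) y by rewrite affE/= subrr mem0v.
  apply; split=> // z; apply; split=> [|b bS]; first exact/convex_setP.
  by have : b \in (finsupp f : seq _) := bS; rewrite S0.
case wE : (argmins w (finsupp f)) => [|a0 T]; first by rewrite wE in aT.
have freeT :=
  face_conv_hull_free _ w a0 T uS newt_dim newt_simplicial vS w_neq0 wE.
(* Both sums vanish, so freeness of the differences would give [c b = 0] for any [b] in [T]. *)
have T_nil : T = [::].
  case: T wE freeT => // b T wE freeT.
  have := free_map_sum freeT (c := c) _ b (mem_head _ _).
  move=> cb; have := c_neq0 b; rewrite cb ?wE ?inE ?eqxx ?orbT => [/(_ isT)//|].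
  transitivity (\sum_(d <- a0 :: b :: T) c d *: (d - a0)).
    by rewrite [RHS]big_cons subrr scaler0 add0r.
  rewrite -wE; under eq_bigr do rewrite scalerBr.
  by rewrite sumrB -scaler_suml cb0 c0 scale0r subrr.
(* A single exponent remains, and its nonzero term would have to vanish at [x]. *)
have /c_neq0 := aT; move: c0 aT; rewrite wE T_nil big_seq1 inE => c0 /eqP->.
by rewrite c0 eqxx.
Qed.
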